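(* Let $\mathbb{U}_1$ and $\mathbb{U}_2$ be two 2-uninorms on $[0,1]$ with 2-neutral elements $\{e_1,f_1\}_{a_1}$ and $\{e_2,f_2\}_{a_2}$, respectively, let $\alpha\in[0,1]$, and put $\lambda=\mathbb{U}_2(\alpha,e_1)$ and $\mu=\mathbb{U}_2(\alpha,f_1)$. (i) If $\mathbb{U}_2(\alpha,f_1)\leq a_1$, then $\mathbb{U}_1$ is $(\alpha,\mathbb{U}_2)$-migrative if and only if $\mathbb{U}_1(\lambda,x)=\mathbb{U}_2(\alpha,x)$ for any $x\in[0,1]$. (ii) If $\mathbb{U}_2(\alpha,f_1)\in[a_1,f_1]$, then $\mathbb{U}_1$ is $(\alpha,\mathbb{U}_2)$-migrative if and only if $$\mathbb{U}_2(\alpha,x)=\begin{cases}\mathbb{U}_1(\lambda,x), & x\in[0,a_1],\\ \mathbb{U}_1(\mu,x), & x\in[a_1,1]\end{cases}$$ and $\mathbb{U}_1(\lambda,x)=\mathbb{U}_1(a_1,x)$ for any $x\in[a_1,1]$. (iii) If $\mathbb{U}_2(\alpha,f_1)\geq f_1$ and $\mathbb{U}_2(\alpha,e_1)\leq a_1$, then $\mathbb{U}_1$ is $(\alpha,\mathbb{U}_2)$-migrative if and only if $$\mathbb{U}_2(\alpha,x)=\begin{cases}\mathbb{U}_1(\lambda,x), & x\in[0,a_1],\\ \mathbb{U}_1(\mu,x), & x\in[a_1,1]\end{cases}$$ and $\mathbb{U}_1(\mu,x)=\mathbb{U}_1(a_1,x)$ for any $x\in[0,a_1]$. (iv) If $\mathbb{U}_2(\alpha,f_1)\geq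 f_1$ and $\mathbb{U}_2(\alpha,e_1)\geq a_1$, then $\mathbb{U}_1$ is $(\alpha,\mathbb{U}_2)$-migrative if and only if $\mathbb{U}_1(\mu,x)=\mathbb{U}_2(\alpha,x)$ for any $x\in[0,1]$.
   Context: For a commutative binary operation $\mathbb{U}:[0,1]^2\to[0,1]$, $\{e,f\}_a$ with $0\leq e\leq a\leq f\leq 1$ is called a 2-neutral element of $\mathbb{U}$ if $\mathbb{U}(e,x)=x$ for all $x\in[0,a]$ and $\mathbb{U}(f,x)=x$ for all $x\in[a,1]$. A binary operation $\mathbb{U}:[0,1]^2\to[0,1]$ is a 2-uninorm if it is commutative, associative, increasing (i.e. non-decreasing) in both variables and has a 2-neutral element $\{e,f\}_a$. For 2-uninorms $\mathbb{U}_1,\mathbb{U}_2$ and $\alpha\in[0,1]$, $\mathbb{U}_1$ is called $(\alpha,\mathbb{U}_2)$-migrative if $\mathbb{U}_1(\mathbb{U}_2(\alpha,x),y)=\mathbb{U}_1(x,\mathbb{U}_2(\alpha,y))$ for all $x,y\in[0,1]$. When a case formula has overlapping pieces (here at $x=a_1$), both expressions are required to give the value. *)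

(* Defs.v *)
From mathcomp Require Import all_boot all_order all_algebra.
From mathcomp Require Import interval_inference reals.

Set Implicit Arguments.
Unset Strict Implicit.
Unset Printing Implicit Defensive.

Import Order.TTheory GRing.Theory Num.Theory.
Local Open Scope ring_scope.

(* The unit interval is the type {i01 R}; since 0 and 1 are its least and
   greatest elements, x \in [0, a] reads x <= a and x \in [a, 1] reads
   a <= x, and the bounds 0 <= e and f <= 1 hold by typing. *)
Definition two_neutral (R : realType) (U : {i01 R} -> {i01 R} -> {i01 R})
    (e f a : {i01 R}) : Prop :=
  [/\ e <= a, a <= f,
      forall x : {i01 R}, x <= a -> U e x = x &
      forall x : {i01 R}, a <= x -> U f x = x].

Definition two_uninorm (R : realType) (U : {i01 R} -> {i01 R} -> {i01 R}) : Prop :=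
  [/\ commutative U, associative U,
      forall y, {homo U^~ y : x x' / x <= x'},
      forall x : {i01 R}, {homo U x : y y' / y <= y'} &
      exists e f a, two_neutral U e f a].

(* migrative alpha U2 U1: U1 is (alpha, U2)-migrative. *)
Definition migrative (R : realType) (alpha : {i01 R})
    (U2 U1 : {i01 R} -> {i01 R} -> {i01 R}) : Prop :=
  forall x y, U1 (U2 alpha x) y = U1 x (U2 alpha y).

(* Main.v *)
Require Import Defs.
From mathcomp Require Import all_boot all_order all_algebra.
From mathcomp Require Import interval_inference reals.

Set Implicit Arguments.
Unset Strict Implicit.
Unset Printing Implicit Defensive.

Import Order.TTheory GRing.Theory Num.Theory.
Local Open Scope ring_scope.

(* Write g x = U2(alpha, x), e, f, a for e1, f1, a1, and x y for U1(x, y).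
   Migrativity reads (g x) y = x (g y), so lambda x = e (g x) and
   mu x = f (g x).  In case (i), g x is at most a, or else
   g x = f (g x) = mu x = e (mu x); either way e fixes g x = lambda x.
   Case (iv) is case (i) for the reverse order.  In cases (ii) and (iii)
   either side of the equivalence forces lambda f = e mu = a.  This gives
   lambda y = lambda (f y) = a y for y >= a, mu x = a x for x <= a and g a = a,
   so g preserves [0, a] and [a, 1] and is given there by the two formulas;
   conversely, for x <= a <= y, lambda x y = lambda (e x) (f y) equals
   mu x y = mu (e x) (f y). *)

Section MigrativeTwoNeutral.
Context (d : Order.disp_t) (T : orderType d).
Local Open Scope order_scope.
Variables (U : T -> T -> T) (g : T -> T) (e f a : T).
Hypotheses (UC : commutative U) (UA : associative U).
Hypotheses (Ue : forall x, x <= a -> U e x = x).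
Hypotheses (Uf : forall x, a <= x -> U f x = x).
Hypothesis leaf : a <= f.
Hypothesis g_homo : {homo g : x y / x <= y}.

Lemma migrative_left_mul c :
  (forall x, U c x = g x) -> forall x y, U (g x) y = U x (g y).
Proof. by move=> gE x y; rewrite -!gE (UC c x) -UA. Qed.

(** Stated over an arbitrary total order so that it also applies to the dual order. *)
Lemma migrative_eq_left (M : forall x y, U (g x) y = U x (g y)) :
  g f <= a -> forall x, U (g e) x = g x.
Proof.
move=> lega x; rewrite M.
have [/Ue //|ltag] := leP (g x) a.
(* In fact [f <= x], since [x < f] would give [g x <= g f <= a]. *)
have leax : a <= x.
  apply: le_trans leaf _; case: leP => // /ltW/g_homo lexf.
  by have := lt_le_trans ltag (le_trans lexf lega); rewrite ltxx.
have gxE : U (g f) x = g x by rewrite M Uf // ltW.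
by rewrite -gxE UA Ue.
Qed.

Section Split.
Hypotheses (lamE : U (g e) f = a) (muE : U e (g f) = a).

Lemma left_mul_upper x : a <= x -> U (g e) x = U a x.
Proof. by move=> leax; rewrite -{1}(Uf leax) UA lamE. Qed.

Lemma right_mul_lower x : x <= a -> U (g f) x = U a x.
Proof. by move=> lexa; rewrite -{1}(Ue lexa) UA (UC (g f)) muE. Qed.

Lemma split_migrative :
    (forall x, x <= a -> g x = U (g e) x) ->
    (forall x, a <= x -> g x = U (g f) x) ->
  forall x y, U (g x) y = U x (g y).
Proof.
have mix x y : x <= a -> a <= y -> U (U (g e) x) y = U x (U (g f) y).
  move=> lexa leay.
  by rewrite -UA (UC x) UA left_mul_upper // UA (UC x) right_mul_lower // -!UA (UC x).
move=> gl gr x y; case: (leP x a) => [lexa|/ltW leax];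
  case: (leP y a) => [leya|/ltW leay].
- by rewrite (gl x) // (gl y) // (UC _ x) -UA.
- by rewrite (gl x) // (gr y) // mix.
- by rewrite (gr x) // (gl y) // UC -mix // UC.
- by rewrite (gr x) // (gr y) // (UC _ x) -UA.
Qed.

Hypothesis Uaa : U a a = a.

Lemma migrative_split (M : forall x y, U (g x) y = U x (g y)) :
  (forall x, x <= a -> g x = U (g e) x) /\ (forall x, a <= x -> g x = U (g f) x).
Proof.
(* If [g a <= a], then [g a = U e (g a) = U (g e) a = U a a = a]; otherwise the same chain runs with
   [f] in place of [e]. *)
have ga : g a = a.
  have [lega|/ltW leag] := leP (g a) a.
    by rewrite -(Ue lega) -M left_mul_upper.
  by rewrite -(Uf leag) -M right_mul_lower.
split=> x /g_homo; rewrite ga => gx; first by rewrite M Ue.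
by rewrite M Uf.
Qed.

End Split.
End MigrativeTwoNeutral.

Theorem theorem3p2 (R : realType) (U1 U2 : {i01 R} -> {i01 R} -> {i01 R})
    (e1 f1 a1 e2 f2 a2 alpha : {i01 R})
    (hU1 : two_uninorm U1) (hU2 : two_uninorm U2)
    (hn1 : two_neutral U1 e1 f1 a1) (hn2 : two_neutral U2 e2 f2 a2) :
  let lambda := U2 alpha e1 in
  let mu := U2 alpha f1 in
  [/\ (* (i) *)
      U2 alpha f1 <= a1 ->
      (migrative alpha U2 U1 <-> forall x : {i01 R}, U1 lambda x = U2 alpha x),
      (* (ii) *)
      a1 <= U2 alpha f1 <= f1 ->
      (migrative alpha U2 U1 <->
       [/\ forall x : {i01 R}, x <= a1 -> U2 alpha x = U1 lambda x,
           forall x : {i01 R}, a1 <= x -> U2 alpha x = U1 mu x &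
           forall x : {i01 R}, a1 <= x -> U1 lambda x = U1 a1 x]),
      (* (iii) *)
      f1 <= U2 alpha f1 -> U2 alpha e1 <= a1 ->
      (migrative alpha U2 U1 <->
       [/\ forall x : {i01 R}, x <= a1 -> U2 alpha x = U1 lambda x,
           forall x : {i01 R}, a1 <= x -> U2 alpha x = U1 mu x &
           forall x : {i01 R}, x <= a1 -> U1 mu x = U1 a1 x]) &
      (* (iv) *)
      f1 <= U2 alpha f1 -> a1 <= U2 alpha e1 ->
      (migrative alpha U2 U1 <-> forall x : {i01 R}, U1 mu x = U2 alpha x)].
Proof.
move=> lambda mu; rewrite /lambda /mu {lambda mu}.
have [UC UA Uml Umr _] := hU1; have [_ _ _ g_homo _] := hU2.
have [leea leaf Ue Uf] := hn1.
have {}g_homo := g_homo alpha; rewrite /migrative.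
move: (U2 alpha) g_homo => g g_homo.
have Uea : U1 e1 a1 = a1 by rewrite Ue.
have Uaf : U1 a1 f1 = a1 by rewrite UC Uf.
(* Squeeze: [U1 e1 a1 <= U1 e1 f1 <= U1 a1 f1], and both ends equal [a1]. *)
have Uef : U1 e1 f1 = a1.
  apply/le_anti/andP; split; first by rewrite -[leRHS]Uaf Uml.
  by rewrite -[leLHS]Uea Umr.
have Uaa : U1 a1 a1 = a1.
  apply/le_anti/andP; split; first by rewrite -[leRHS]Uaf Umr.
  by rewrite -[leLHS]Uea Uml.
split.
- move=> legfa; split; last exact: migrative_left_mul.
  by move=> M; apply: (migrative_eq_left (f := f1) (a := a1)).
- case/andP=> leag legf.
  have muE : U1 e1 (g f1) = a1.
    apply/le_anti/andP; split; last by rewrite -[leLHS]Uea Umr.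
    by rewrite -[leRHS]Uef Umr.
  split=> [M|[gl gr le]].
    have lamE : U1 (g e1) f1 = a1 by rewrite M.
    have [gl gr] := migrative_split UC UA Ue Uf g_homo lamE muE Uaa M.
    by split=> // x lex; apply: (left_mul_upper UA Uf lamE lex).
  have lamE : U1 (g e1) f1 = a1 by rewrite le.
  exact: split_migrative UC UA Ue Uf lamE muE gl gr.
- move=> lefg lega.
  have lamle : U1 (g e1) f1 <= a1 by rewrite -[leRHS]Uaf Uml.
  have mule : a1 <= U1 e1 (g f1) by rewrite -[leLHS]Uef Umr.
  split=> [M|[gl gr mua]].
    (* Migrativity equates the two products, which lie on opposite sides of [a1]. *)
    have lamE : U1 (g e1) f1 = a1 by apply: le_anti; rewrite lamle M mule.
    have muE : U1 e1 (g f1) = a1 by rewrite -M.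
    have [gl gr] := migrative_split UC UA Ue Uf g_homo lamE muE Uaa M.
    by split=> // x lex; apply: (right_mul_lower UC UA Ue muE lex).
  have lamE : U1 (g e1) f1 = a1.
    apply: le_anti; rewrite lamle /=.
    (* Both case formulas hold at the overlap point [a1], so [U1 (g e1) a1 = g a1 = U1 (g f1) a1 =
       U1 a1 a1]. *)
    have <- : U1 (g e1) a1 = a1 by rewrite -gl // gr // mua.
    exact: Umr.
  have muE : U1 e1 (g f1) = a1 by rewrite UC mua // UC.
  exact: split_migrative UC UA Ue Uf lamE muE gl gr.
- move=> _ leag; split; last exact: migrative_left_mul.
  move=> M.
  (* Reversing the order swaps [e1] and [f1] and turns the bound [g f <= a] into [a1 <= g e1]. *)
  apply: (@migrative_eq_left _ {i01 R}^d U1 g f1 e1 a1) => //.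
  by move=> x y; apply: g_homo.
Qed.
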